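(* Let $\mathcal{D}$ be a complex pre-Hilbert space and let $Q\subseteq\mathfrak{L}^*(\mathcal{D})$ be a dominant subset such that $Q^\downarrow$ is a closed $O^*$-algebra. Then $Q^\downarrow$ is a $\mathit{Su}^*$-algebra if and only if every $q\in Q$ is invertible in $\mathfrak{L}^*(\mathcal{D})$.
   Context: A $^*$-algebra is a unital associative complex algebra $\mathcal{A}$ (unit $\mathbb{1}$) with an antilinear involution $a\mapsto a^*$ satisfying $(ab)^*=b^*a^*$; $\mathcal{A}_{\mathrm{H}}=\{a\in\mathcal{A}: a=a^*\}$. An ordered $^*$-algebra is a $^*$-algebra $\mathcal{A}$ with a partial order $\le$ on $\mathcal{A}_{\mathrm{H}}$ such that $a+c\le b+c$, $d^*ad\le d^*bd$ and $0\le\mathbb{1}$ for all $a,b,c\in\mathcal{A}_{\mathrm{H}}$ with $a\le b$ and all $d\in\mathcal{A}$. Write $\mathcal{A}_{\mathrm{H}}^+=\{a\in\mathcal{A}_{\mathrm{H}}:a\ge0\}$. It is Archimedean if, for $v,w\in\mathcal{A}_{\mathrm{H}}$, $v\le\epsilon w$ for all $\epsilon>0$ implies $v\le 0$. An element $a\in\mathcal{A}_{\mathrm{H}}$ is coercive if $a\ge\epsilon\mathbb{1}$ for some $\epsilon>0$. For $a\in\mathcal{A}$ let $\|a\|_\infty=\inf\{\lambda\in\,]0,\infty[\,: a^*a\le\lambda^2\mathbb{1}\}\in[0,\infty]$; an Archimedean ordered $^*$-algebra is uniformly complete if it is complete with respect to the metric $\mathrm{d}_\infty(a,b)=\min\{\|a-b\|_\infty,1\}$.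 A $\mathit{Su}^*$-algebra is a uniformly complete Archimedean ordered $^*$-algebra in which every coercive element is invertible (for uniformly complete Archimedean ordered $^*$-algebras the latter is one of several equivalent conditions). For a complex pre-Hilbert space $\mathcal{D}$, $\mathfrak{L}^*(\mathcal{D})$ is the $^*$-algebra of all linear $a:\mathcal{D}\to\mathcal{D}$ that have an adjoint $a^*:\mathcal{D}\to\mathcal{D}$ with $\langle a^*(\xi)|\eta\rangle=\langle\xi|a(\eta)\rangle$ for all $\xi,\eta\in\mathcal{D}$, with the order on Hermitian elements: $a\le b$ iff $\langle\xi|a(\xi)\rangle\le\langle\xi|b(\xi)\rangle$ for all $\xi\in\mathcal{D}$; it is an Archimedean ordered $^*$-algebra. An $O^*$-algebra on $\mathcal{D}$ is a unital $^*$-subalgebra of $\mathfrak{L}^*(\mathcal{D})$, with the inherited order. The graph topology induced by an $O^*$-algebra $\mathcal{A}$ on $\mathcal{D}$ is the locally convex topology defined by all seminorms $\xi\mapsto\langle\xi|b(\xi)\rangle^{1/2}$ with $b\in\mathcal{A}_{\mathrm{H}}^+$; $\mathcal{A}$ is closed if $\mathcal{D}$ is complete in the graph topology of $\mathcal{A}$. A dominant subset of an ordered $^*$-algebra $\mathcal{A}$ is a subset $Q\subseteq\mathcal{A}$ of normal ($q^*q=qq^*$) and pairwise commuting elements, stable under $^*$, with $\mathbb{1}\in Q$, and such that $q^*q$ is coercive, $\lambda q\in Q$ and $qr\in Q$ for all $\lambda\in[1,\infty[$ and all $q,r\in Q$. With $Q'$ the commutant of $Q$ in $\mathcal{A}$,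 one sets $Q^\downarrow=\{a\in Q' : \exists q\in Q:\ a^*a\le q^*q\text{ and }aa^*\le q^*q\}$; this is a unital $^*$-subalgebra of $\mathcal{A}$ containing $Q$. Here $\mathcal{A}=\mathfrak{L}^*(\mathcal{D})$. *)

(* Defs.v *)
From HB Require Import structures.
From mathcomp Require Import all_boot all_order all_algebra.
From mathcomp Require Import sesquilinear complex ring lra.
From mathcomp Require Import all_classical all_reals ereal topology.
From mathcomp Require Import normedtype sequences.

Set Implicit Arguments.
Unset Strict Implicit.
Unset Printing Implicit Defensive.

Import Order.TTheory GRing.Theory Num.Theory.
Import numFieldTopology.Exports.

Local Open Scope classical_set_scope.
Local Open Scope ring_scope.

Reserved Notation "k *c a" (at level 40, left associativity).
Reserved Notation "a ^*s" (at level 2, format "a ^*s").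

(* A unital associative complex algebra with involution.  The algebra
   structures of ssralg extend nzRingType, hence exclude the zero algebra; we
   start from pzRingType and carry the scalar multiplication in the mixin, so
   that the operators on the space {0} are covered. *)
HB.mixin Record isStarAlgebra (R : realType) A of GRing.PzRing A := {
  cscale : R[i] -> A -> A ;
  cscaleA : forall k l a, cscale k (cscale l a) = cscale (k * l) a ;
  cscale1 : forall a, cscale 1 a = a ;
  cscaleDr : forall k a b, cscale k (a + b) = cscale k a + cscale k b ;
  cscaleDl : forall k l a, cscale (k + l) a = cscale k a + cscale l a ;
  cscaleAl : forall k a b, cscale k (a * b) = cscale k a * b ;
  cscaleAr : forall k a b, cscale k (a * b) = a * cscale k b ;
  star : A -> A ;
  starK : forall a, star (star a) = a ;
  starD : forall a b, star (a + b) = star a + star b ;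
  starZ : forall k a, star (cscale k a) = cscale (Num.conj k) (star a) ;
  starM : forall a b, star (a * b) = star b * star a
}.

#[short(type="starAlgType")]
HB.structure Definition StarAlgebra (R : realType) :=
  {A of GRing.PzRing A & isStarAlgebra R A}.

Arguments star {R s} a.
Notation "k *c a" := (cscale k a) : ring_scope.
Notation "a ^*s" := (star a) : ring_scope.
Notation rtoC r := (real_complex _ r).

Definition is_hermitian (R : realType) (A : starAlgType R) (a : A) : Prop :=
  a^*s = a.

(* The order lives on the Hermitian elements: [leH a b] entails that a and b
   are Hermitian. *)
HB.mixin Record isOrderedStarAlgebra (R : realType) A of StarAlgebra R A := {
  leH : A -> A -> Prop ;
  leH_herm : forall a b, leH a b -> is_hermitian a /\ is_hermitian b ;
  leH_refl : forall a, is_hermitian a -> leH a a ;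
  leH_anti : forall a b, leH a b -> leH b a -> a = b ;
  leH_trans : forall b a c, leH a b -> leH b c -> leH a c ;
  leH_add : forall a b c, is_hermitian c -> leH a b -> leH (a + c) (b + c) ;
  leH_conj : forall a b d, leH a b -> leH (d^*s * a * d) (d^*s * b * d) ;
  leH_01 : leH 0 1
}.

#[short(type="ordStarAlgType")]
HB.structure Definition OrderedStarAlgebra (R : realType) :=
  {A of StarAlgebra R A & isOrderedStarAlgebra R A}.

Section OrderedStarAlgebraNotions.
Variables (R : realType) (A : ordStarAlgType R).
Implicit Types (a b v w : A) (S Q : set A).

Definition archimedean : Prop :=
  forall v w, is_hermitian v -> is_hermitian w ->
    (forall e : R, 0 < e -> leH v (rtoC e *c w)) -> leH v 0.

Definition coercive a : Prop := exists2 e : R, 0 < e & leH (rtoC e *c 1) a.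

Definition invertible a : Prop := exists b, a * b = 1 /\ b * a = 1.

Definition norm_oo a : \bar R :=
  ereal_inf [set l%:E | l in
    [set l : R | 0 < l /\ leH (a^*s * a) (rtoC (l ^+ 2) *c 1)]].

Definition dist_oo a b : R := fine (Order.min (norm_oo (a - b)) 1%E).

Definition uniformly_complete : Prop :=
  forall u : nat -> A,
    (forall e : R, 0 < e -> exists N : nat, forall m n : nat,
      (N <= m)%N -> (N <= n)%N -> dist_oo (u m) (u n) < e) ->
    exists a, dist_oo (u n) a @[n --> \oo] --> (0 : R).

Definition Su_star_algebra : Prop :=
  [/\ archimedean, uniformly_complete & forall a, coercive a -> invertible a].

Definition star_subalgebra S : Prop :=
  [/\ S 1,
      forall a b, S a -> S b -> S (a + b),
      forall (k : R[i]) a, S a -> S (k *c a),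
      forall a b, S a -> S b -> S (a * b) &
      forall a, S a -> S (a^*s)].

Definition dominant Q : Prop :=
  [/\ forall q, Q q -> q^*s * q = q * q^*s,
      forall q r, Q q -> Q r -> q * r = r * q,
      forall q, Q q -> Q (q^*s) &
      Q 1] /\
  [/\ forall q, Q q -> coercive (q^*s * q),
      forall (l : R) q, 1 <= l -> Q q -> Q (rtoC l *c q) &
      forall q r, Q q -> Q r -> Q (q * r)].

Definition commutant Q : set A := [set a | forall q, Q q -> a * q = q * a].

Definition down_algebra Q : set A :=
  [set a | commutant Q a /\
    exists2 q, Q q & leH (a^*s * a) (q^*s * q) /\ leH (a * a^*s) (q^*s * q)].

End OrderedStarAlgebraNotions.

Arguments archimedean {R} A.
Arguments uniformly_complete {R} A.
Arguments Su_star_algebra {R} A.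

Section CscaleTheory.
Variables (R : realType) (A : starAlgType R).
Implicit Types (a b : A) (k : R[i]).

Lemma cscale0 a : 0 *c a = 0 :> A.
Proof. by apply: (addrI (0 *c a)); rewrite -cscaleDl !addr0. Qed.

Lemma cscaleN1 a : (-1) *c a = - a :> A.
Proof.
by apply/eqP; rewrite -addr_eq0 -{2}[a]cscale1 -cscaleDl addNr cscale0.
Qed.

Lemma star1 : 1^*s = 1 :> A.
Proof. by rewrite -[LHS]mul1r -{1}[1]starK -starM mul1r starK. Qed.

Lemma star0 : 0^*s = 0 :> A.
Proof. by apply: (addrI (0^*s)); rewrite -starD !addr0. Qed.
End CscaleTheory.

Section SubAlgebra.
Variables (R : realType) (A : ordStarAlgType R) (S : set A).

Definition sub_mem (HS : star_subalgebra S) : {pred A} := fun a => a \in S.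

Definition sub_algebra (HS : star_subalgebra S) : Type :=
  {a : A | sub_mem HS a}.

Variable HS : star_subalgebra S.
Local Notation T := (sub_algebra HS).

HB.instance Definition _ := [isSub of T for @sval A (sub_mem HS)].
HB.instance Definition _ := [Choice of T by <:].

Fact sub_subring : subring_closed (sub_mem HS).
Proof.
have [S1 SD SZ SM _] := HS; split; rewrite /sub_mem ?unfold_in.
- exact/mem_set.
- move=> a b /set_mem Sa /set_mem Sb; apply/mem_set/SD => //.
  by rewrite -cscaleN1; exact: SZ.
- by move=> a b /set_mem Sa /set_mem Sb; exact/mem_set/SM.
Qed.

HB.instance Definition _ := GRing.SubChoice_isSubPzRing.Build A (sub_mem HS) T
  sub_subring.

Fact sub_scaleP (k : R[i]) (a : T) : sub_mem HS (k *c val a).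
Proof. by have [_ _ SZ _ _] := HS; exact/mem_set/SZ/set_mem/(valP a). Qed.

Fact sub_starP (a : T) : sub_mem HS ((val a)^*s).
Proof. by have [_ _ _ _ SV] := HS; exact/mem_set/SV/set_mem/(valP a). Qed.

Definition sub_scale k (a : T) : T := Sub (k *c val a) (sub_scaleP k a).
Definition sub_star (a : T) : T := Sub ((val a)^*s) (sub_starP a).
Definition sub_le (a b : T) : Prop := leH (val a) (val b).

Fact sub_scaleA k l a : sub_scale k (sub_scale l a) = sub_scale (k * l) a.
Proof. by apply: val_inj; exact: cscaleA. Qed.
Fact sub_scale1 a : sub_scale 1 a = a.
Proof. by apply: val_inj; exact: cscale1. Qed.
Fact sub_scaleDr k a b : sub_scale k (a + b) = sub_scale k a + sub_scale k b.
Proof. by apply: val_inj; exact: cscaleDr. Qed.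
Fact sub_scaleDl k l a : sub_scale (k + l) a = sub_scale k a + sub_scale l a.
Proof. by apply: val_inj; exact: cscaleDl. Qed.
Fact sub_scaleAl k a b : sub_scale k (a * b) = sub_scale k a * b.
Proof. by apply: val_inj; exact: cscaleAl. Qed.
Fact sub_scaleAr k a b : sub_scale k (a * b) = a * sub_scale k b.
Proof. by apply: val_inj; exact: cscaleAr. Qed.
Fact sub_starK a : sub_star (sub_star a) = a.
Proof. by apply: val_inj; exact: starK. Qed.
Fact sub_starD a b : sub_star (a + b) = sub_star a + sub_star b.
Proof. by apply: val_inj; exact: starD. Qed.
Fact sub_starZ k a : sub_star (sub_scale k a) = sub_scale (Num.conj k) (sub_star a).
Proof. by apply: val_inj; exact: starZ. Qed.
Fact sub_starM a b : sub_star (a * b) = sub_star b * sub_star a.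
Proof. by apply: val_inj; exact: starM. Qed.

HB.instance Definition _ := isStarAlgebra.Build R T sub_scaleA sub_scale1
  sub_scaleDr sub_scaleDl sub_scaleAl sub_scaleAr sub_starK sub_starD sub_starZ
  sub_starM.

Fact sub_hermitianE (a : T) : is_hermitian a <-> is_hermitian (val a).
Proof. by split=> [/(congr1 val)//|h]; apply: val_inj. Qed.

Fact sub_le_herm a b : sub_le a b -> is_hermitian a /\ is_hermitian b.
Proof. by move=> /leH_herm[? ?]; split; exact/sub_hermitianE. Qed.
Fact sub_le_refl (a : T) : is_hermitian a -> sub_le a a.
Proof. by move/sub_hermitianE; exact: leH_refl. Qed.
Fact sub_le_anti a b : sub_le a b -> sub_le b a -> a = b.
Proof. by move=> ab ba; apply: val_inj; exact: leH_anti. Qed.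
Fact sub_le_trans b a c : sub_le a b -> sub_le b c -> sub_le a c.
Proof. exact: leH_trans. Qed.
Fact sub_le_add a b (c : T) : is_hermitian c -> sub_le a b -> sub_le (a + c) (b + c).
Proof. by move/sub_hermitianE; exact: leH_add. Qed.
Fact sub_le_conj a b (d : T) :
  sub_le a b -> sub_le (d^*s * a * d) (d^*s * b * d).
Proof. exact: leH_conj. Qed.
Fact sub_le_01 : sub_le 0 1.
Proof. exact: leH_01. Qed.

HB.instance Definition _ := isOrderedStarAlgebra.Build R T sub_le_herm
  sub_le_refl sub_le_anti sub_le_trans sub_le_add sub_le_conj sub_le_01.
End SubAlgebra.

Lemma real_form_bound (R : realFieldType) (r s k : R) : 0 <= r -> 0 <= s ->
  (forall x y, 0 <= x ^+ 2 * r ^+ 2 + y ^+ 2 * s ^+ 2 + x * y * k) ->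
  k <= 2 * r * s.
Proof.
move=> r0 s0 q; rewrite leNgt; apply/negP => k0.
have [r00|rn0] := eqVneq r 0.
  have kp : 0 < k by rewrite r00 mulr0 mul0r in k0.
  have := q (- (s ^+ 2 + 1) / k) 1; rewrite r00 expr0n /= mulr0 add0r.
  by rewrite mulr1 divfK ?gt_eqF // expr1n mul1r opprD addNKr ler0N1.
have [s00|sn0] := eqVneq s 0.
  have kp : 0 < k by rewrite s00 mulr0 in k0.
  have := q 1 (- (r ^+ 2 + 1) / k); rewrite s00 expr0n /= mulr0 addr0.
  by rewrite mul1r divfK ?gt_eqF // expr1n mul1r opprD addNKr ler0N1.
have rp : 0 < r by rewrite lt_def rn0.
have sp : 0 < s by rewrite lt_def sn0.
have := q s (- r); have rsp : 0 < r * s by exact: mulr_gt0.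
have -> : s ^+ 2 * r ^+ 2 + (- r) ^+ 2 * s ^+ 2 + s * - r * k =
  (r * s) * (2 * r * s - k) by ring.
by rewrite pmulr_rge0 // subr_ge0 leNgt k0.
Qed.

Section PreHilbert.
Variables (R : realType) (D : lmodType R[i]).
Variable form : {dot D for @Num.conj R[i]}.

(* Forms of the library are linear in the first argument; here the inner
   product is linear in the second one. *)
Definition inner (x y : D) : R[i] := form y x.

Local Notation "<< x , y >>" := (inner x y) (at level 0, x, y at level 69).

Lemma innerDl x y z : <<x + y, z>> = <<x, z>> + <<y, z>>.
Proof. by rewrite /inner linearDr. Qed.
Lemma innerDr x y z : <<x, y + z>> = <<x, y>> + <<x, z>>.
Proof. by rewrite /inner linearDl. Qed.
Lemma innerZl k x y : <<k *: x, y>> = Num.conj k * <<x, y>>.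
Proof. by rewrite /inner linearZr_LR. Qed.
Lemma innerZr k x y : <<x, k *: y>> = k * <<x, y>>.
Proof. by rewrite /inner linearZl_LR. Qed.
Lemma innerNl x y : <<- x, y>> = - <<x, y>>.
Proof. by rewrite /inner linearNr. Qed.
Lemma innerNr x y : <<x, - y>> = - <<x, y>>.
Proof. by rewrite /inner linearNl. Qed.
Lemma inner0l x : <<0, x>> = 0. Proof. by rewrite /inner linear0r. Qed.
Lemma inner0r x : <<x, 0>> = 0. Proof. by rewrite /inner linear0l. Qed.
Lemma inner_conj x y : <<x, y>> = Num.conj <<y, x>>.
Proof. by rewrite /inner hermC mul1r. Qed.
Lemma inner_ge0 x : 0 <= <<x, x>>.
Proof. exact: dnorm_ge0. Qed.
Lemma inner_eq0 x : <<x, x>> = 0 -> x = 0.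
Proof. by move/eqP; rewrite dnorm_eq0 => /eqP. Qed.
Lemma inner_injr x y : (forall z, <<z, x>> = <<z, y>>) -> x = y.
Proof.
move=> xy; apply/eqP; rewrite -subr_eq0; apply/eqP/inner_eq0.
by rewrite innerDr innerNr xy subrr.
Qed.
Lemma inner_injl x y : (forall z, <<x, z>> = <<y, z>>) -> x = y.
Proof. by move=> xy; apply: inner_injr => z; rewrite inner_conj xy -inner_conj. Qed.

Definition is_adjoint (b a : D -> D) : Prop :=
  forall x y, <<b x, y>> = <<x, a y>>.

Definition adjointable : {pred D -> D} :=
  fun a => `[< linear a /\ exists2 b, linear b & is_adjoint b a >].

Definition Lstar : Type := {a : D -> D | adjointable a}.

HB.instance Definition _ := [isSub of Lstar for @sval (D -> D) adjointable].
HB.instance Definition _ := [Choice of Lstar by <:].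

Definition op (a : Lstar) : D -> D := val a.
Coercion op : Lstar >-> Funclass.

Fact adjointable_zmod : zmod_closed adjointable.
Proof.
split.
  apply/asboolP; split; first by move=> k x y; rewrite /= scaler0 addr0.
  exists (fun=> 0); first by move=> k x y; rewrite scaler0 addr0.
  by move=> x y; rewrite -[RHS]/(inner x 0) inner0l inner0r.
move=> a a' /asboolP[la [b lb ab]] /asboolP[la' [b' lb' ab']].
apply/asboolP; split.
  by move=> k x y; rewrite !fctE la la' scalerBr opprD addrACA.
exists (fun x => b x - b' x).
  by move=> k x y; rewrite lb lb' scalerBr opprD addrACA.
by move=> x y; rewrite innerDl innerNl ab ab' !fctE innerDr innerNr.
Qed.

HB.instance Definition _ :=
  GRing.SubChoice_isSubZmodule.Build (D -> D) adjointable Lstar adjointable_zmod.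

Lemma op_adjointable (a : Lstar) :
  linear a /\ exists2 b, linear b & is_adjoint b a.
Proof. exact/asboolP/(valP a). Qed.
Lemma op_linear (a : Lstar) : linear a.
Proof. by have [] := op_adjointable a. Qed.
Lemma opP (a a' : Lstar) : (forall x, a x = a' x) -> a = a'.
Proof. by move=> aa'; apply: val_inj; exact/funext. Qed.

Fact adjointable_comp (a a' : Lstar) : adjointable (a \o a').
Proof.
have [la [b lb ab]] := op_adjointable a.
have [la' [b' lb' ab']] := op_adjointable a'.
apply/asboolP; split; first by move=> k x y /=; rewrite la' la.
exists (b' \o b); first by move=> k x y /=; rewrite lb lb'.
by move=> x y /=; rewrite ab' ab.
Qed.

Fact adjointable_id : adjointable id.
Proof. by apply/asboolP; split => //; exists id. Qed.

Fact adjointable_scale k (a : Lstar) : adjointable (k \*: (a : D -> D)).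
Proof.
have [la [b lb ab]] := op_adjointable a; apply/asboolP; split.
  by move=> l x y /=; rewrite la scalerDr !scalerA mulrC.
exists (Num.conj k \*: b).
  by move=> l x y /=; rewrite lb scalerDr !scalerA mulrC.
by move=> x y /=; rewrite innerZl innerZr conjCK ab.
Qed.

Fact adjoint_ex (a : Lstar) : {b : Lstar | is_adjoint b a}.
Proof.
apply: cid; have [la [b lb ab]] := op_adjointable a.
suff bP : adjointable b by exists (exist _ b bP).
apply/asboolP; split=> //; exists (op a) => // x y.
by rewrite inner_conj -ab -inner_conj.
Qed.

Definition Lmul (a b : Lstar) : Lstar := Sub (a \o b) (adjointable_comp a b).
Definition Lone : Lstar := Sub id adjointable_id.
Definition Lscale k (a : Lstar) : Lstar :=
  Sub (k \*: (a : D -> D)) (adjointable_scale k a).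
Definition Ladj (a : Lstar) : Lstar := sval (adjoint_ex a).

Lemma LadjP (a : Lstar) x y : <<Ladj a x, y>> = <<x, a y>>.
Proof. exact: (svalP (adjoint_ex a)). Qed.
Lemma LadjPr (a : Lstar) x y : <<a x, y>> = <<x, Ladj a y>>.
Proof. by rewrite inner_conj -LadjP -inner_conj. Qed.

Lemma opDr (a : Lstar) x y : a (x + y) = a x + a y.
Proof. by have := op_linear a 1 x y; rewrite !scale1r. Qed.
Lemma op0 (a : Lstar) : a 0 = 0.
Proof. by apply: (addrI (a 0)); rewrite -opDr !addr0. Qed.
Lemma opZ (a : Lstar) k x : a (k *: x) = k *: a x.
Proof. by have := op_linear a k x 0; rewrite op0 !addr0. Qed.
Lemma opN (a : Lstar) x : a (- x) = - a x.
Proof. by rewrite -scaleN1r opZ scaleN1r. Qed.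
Lemma opD (a b : Lstar) x : op (a + b) x = a x + b x. Proof. by []. Qed.

Fact LmulA : associative Lmul. Proof. by move=> a b c; exact: opP. Qed.
Fact Lmul1 : left_id Lone Lmul. Proof. by move=> a; exact: opP. Qed.
Fact Lmulr1 : right_id Lone Lmul. Proof. by move=> a; exact: opP. Qed.
Fact LmulDl : left_distributive Lmul +%R.
Proof. by move=> a b c; exact: opP. Qed.
Fact LmulDr : right_distributive Lmul +%R.
Proof. by move=> a b c; apply: opP => x; exact: opDr. Qed.

HB.instance Definition _ :=
  GRing.Zmodule_isPzRing.Build Lstar LmulA Lmul1 Lmulr1 LmulDl LmulDr.

Lemma opM (a b : Lstar) x : op (a * b) x = a (b x). Proof. by []. Qed.
Lemma op1 x : op 1 x = x. Proof. by []. Qed.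

Fact LscaleA k l a : Lscale k (Lscale l a) = Lscale (k * l) a.
Proof. by apply: opP => x; exact: scalerA. Qed.
Fact Lscale1 a : Lscale 1 a = a.
Proof. by apply: opP => x; exact: scale1r. Qed.
Fact LscaleDr k a b : Lscale k (a + b) = Lscale k a + Lscale k b.
Proof. by apply: opP => x; exact: scalerDr. Qed.
Fact LscaleDl k l a : Lscale (k + l) a = Lscale k a + Lscale l a.
Proof. by apply: opP => x; exact: scalerDl. Qed.
Fact LscaleAl k a b : Lscale k (a * b) = Lscale k a * b.
Proof. by apply: opP. Qed.
Fact LscaleAr k a b : Lscale k (a * b) = a * Lscale k b.
Proof. by apply: opP => x; rewrite opM /= opZ. Qed.
Fact LadjK a : Ladj (Ladj a) = a.
Proof. by apply: opP => x; apply: inner_injl => y; rewrite LadjP -LadjPr. Qed.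
Fact LadjD a b : Ladj (a + b) = Ladj a + Ladj b.
Proof.
apply: opP => x; apply: inner_injl => y.
by rewrite LadjP !opD innerDl !LadjP innerDr.
Qed.
Fact LadjZ k a : Ladj (Lscale k a) = Lscale (Num.conj k) (Ladj a).
Proof.
apply: opP => x; apply: inner_injl => y.
by rewrite LadjP /= innerZl innerZr conjCK LadjP.
Qed.
Fact LadjM a b : Ladj (a * b) = Ladj b * Ladj a.
Proof. by apply: opP => x; apply: inner_injl => y; rewrite opM !LadjP. Qed.

HB.instance Definition _ := isStarAlgebra.Build R Lstar LscaleA Lscale1
  LscaleDr LscaleDl LscaleAl LscaleAr LadjK LadjD LadjZ LadjM.

Lemma op_star (a : Lstar) x y : <<op a^*s x, y>> = <<x, a y>>.
Proof. exact: LadjP. Qed.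

Definition Lle (a b : Lstar) : Prop :=
  [/\ is_hermitian a, is_hermitian b & forall x, <<x, a x>> <= <<x, b x>>].

Fact Lle_herm a b : Lle a b -> is_hermitian a /\ is_hermitian b.
Proof. by case. Qed.
Fact Lle_refl (a : Lstar) : is_hermitian a -> Lle a a.
Proof. by move=> ha; split. Qed.
Fact Lle_trans b a c : Lle a b -> Lle b c -> Lle a c.
Proof. by move=> [ha _ ab] [_ hc bc]; split=> // x; exact: le_trans (bc x). Qed.

Lemma op_polarization (c : Lstar) : (forall x, <<x, c x>> = 0) -> c = 0.
Proof.
move=> q0; apply: opP => x; apply: inner_injr => z.
have pol y : <<z, c y>> + <<y, c z>> = 0.
  by have := q0 (z + y); rewrite opDr innerDl !innerDr !q0 addr0 add0r.
have := pol ('i *: x); rewrite opZ innerZl innerZr conjCi mulNr -mulrBr.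
move/eqP; rewrite mulf_eq0 (negPf (neq0Ci _)) /= subr_eq0 => /eqP e.
have := pol x; rewrite -e -mulr2n => /eqP; rewrite mulrn_eq0 /= => /eqP ->.
by rewrite -[RHS]/(inner z 0) inner0r.
Qed.

Fact Lle_anti a b : Lle a b -> Lle b a -> a = b.
Proof.
move=> [_ _ ab] [_ _ ba]; apply/eqP; rewrite -subr_eq0; apply/eqP.
apply: op_polarization => x.
rewrite opD innerDr -[op (- b) x]/(- (b x)) innerNr; apply/eqP.
by rewrite subr_eq0 eq_le ab ba.
Qed.

Lemma hermitianD (a b : Lstar) : is_hermitian a -> is_hermitian b -> is_hermitian (a + b).
Proof. by rewrite /is_hermitian starD => -> ->. Qed.

Fact Lle_add a b (c : Lstar) : is_hermitian c -> Lle a b -> Lle (a + c) (b + c).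
Proof.
move=> hc [ha hb ab]; split; [exact: hermitianD|exact: hermitianD|] => x.
by rewrite !opD !innerDr lerD2r.
Qed.

Fact Lle_conj a b (d : Lstar) : Lle a b -> Lle (d^*s * a * d) (d^*s * b * d).
Proof.
move=> [ha hb ab]; split.
- by rewrite /is_hermitian !starM starK ha mulrA.
- by rewrite /is_hermitian !starM starK hb mulrA.
- by move=> x; rewrite !opM -2!(LadjPr d); exact: ab.
Qed.

Fact Lle_01 : Lle 0 1.
Proof.
split; [exact: star0|exact: star1|move=> x].
by rewrite inner0r; exact: inner_ge0.
Qed.

HB.instance Definition _ := isOrderedStarAlgebra.Build R Lstar Lle_herm
  Lle_refl Lle_anti Lle_trans Lle_add Lle_conj Lle_01.

(* For an adjointable operator b >= 0 the complex number <<x, b x>> is real and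
   nonnegative. *)
Definition graph_seminorm (b : Lstar) (x : D) : R :=
  Num.sqrt (complex.Re <<x, b x>>).

Section GraphSeminorm.
Variables (b : Lstar) (b_ge0 : leH 0 b).
Local Notation p := (graph_seminorm b).
Local Notation h x := (complex.Re <<x, b x>>).

Lemma graph_form_ge0 x : 0 <= h x.
Proof. by have [_ _ /(_ x)] := b_ge0; rewrite inner0r lecE => /andP[]. Qed.

Lemma graph_seminorm0 : p 0 = 0.
Proof. by rewrite /graph_seminorm inner0l sqrtr0. Qed.

Lemma graph_seminormN x : p (- x) = p x.
Proof. by rewrite /graph_seminorm opN innerNl innerNr opprK. Qed.

Lemma graph_formZD (s t : R) x y :
  h (rtoC s *: x + rtoC t *: y) =
  s ^+ 2 * h x + t ^+ 2 * h y
  + s * t * (complex.Re <<x, b y>> + complex.Re <<y, b x>>).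
Proof.
have conjr (r : R) : Num.conj (rtoC r) = rtoC r.
  by rewrite -[LHS]/(conjc _) /= oppr0.
rewrite opDr !opZ !innerDl !innerDr !innerZl !innerZr !conjr.
case: <<x, b x>> <<y, b y>> <<x, b y>> <<y, b x>> => [? ?] [? ?] [? ?] [? ?] /=.
by ring.
Qed.

Lemma graph_seminormD x y : p (x + y) <= p x + p y.
Proof.
have hxy := graph_formZD 1 1 x y; rewrite !scale1r in hxy.
have px2 : p x ^+ 2 = h x by rewrite sqr_sqrtr // graph_form_ge0.
have py2 : p y ^+ 2 = h y by rewrite sqr_sqrtr // graph_form_ge0.
have px0 : 0 <= p x by exact: sqrtr_ge0.
have py0 : 0 <= p y by exact: sqrtr_ge0.
have K : complex.Re <<x, b y>> + complex.Re <<y, b x>> <= 2 * p x * p y.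
  apply: real_form_bound => // s t; rewrite px2 py2 -graph_formZD.
  exact: graph_form_ge0.
rewrite -(ler_pXn2r (n := 2)) ?nnegrE ?addr_ge0 ?sqrtr_ge0 //.
rewrite sqr_sqrtr ?graph_form_ge0 // hxy sqrrD px2 py2; lra.
Qed.
End GraphSeminorm.

Definition seminorm_space (b : {b : Lstar | leH 0 b}) : Type := D.

Section SeminormSpace.
Variable b : {b : Lstar | leH 0 b}.
Local Notation p := (graph_seminorm (sval b)).
Local Notation T := (seminorm_space b).

Definition seminorm_ball (x : D) (e : R) : set D := [set y | p (x - y) < e].

HB.instance Definition _ := Choice.copy T D.
HB.instance Definition _ :=
  hasNbhs.Build T (nbhs_ (entourage_ seminorm_ball)).

Fact seminorm_ball_center x e : 0 < e -> seminorm_ball x e x.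
Proof. by rewrite /seminorm_ball /= subrr graph_seminorm0. Qed.

Fact seminorm_ball_sym x y e : seminorm_ball x e y -> seminorm_ball y e x.
Proof. by rewrite /seminorm_ball /= -graph_seminormN opprB. Qed.

Fact seminorm_ball_triangle x y z e f :
  seminorm_ball x e y -> seminorm_ball y f z -> seminorm_ball x (e + f) z.
Proof.
rewrite /seminorm_ball /= => xy yz; rewrite -(subrK y x) -addrA.
exact: le_lt_trans (graph_seminormD (svalP b) _ _) (ltrD xy yz).
Qed.

HB.instance Definition _ := @Nbhs_isPseudoMetric.Build R T
  (entourage_ seminorm_ball) erefl seminorm_ball seminorm_ball_center
  seminorm_ball_sym seminorm_ball_triangle erefl.
End SeminormSpace.

(* D with the graph topology of S: the locally convex (uniform) topology of the
   seminorms <<x, b x>>^(1/2), where b ranges over the positive elements of S. *)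
Definition graph_space (S : set Lstar) : Type :=
  sup_topology (fun b : {b : {b : Lstar | leH 0 b} | S (sval b)} =>
    Uniform.class (seminorm_space (sval b))).

HB.instance Definition _ (S : set Lstar) := Uniform.on (graph_space S).

Definition Ostar_algebra (S : set Lstar) : Prop := star_subalgebra S.

Definition Ostar_closed (S : set Lstar) : Prop :=
  forall F : set_system (graph_space S), ProperFilter F -> cauchy F ->
    exists x : graph_space S, F --> x.

End PreHilbert.

(* Main.v *)
(* Graph-topology Cauchy sequences are controlled by the norms |q x|, q in Q,
   because every Hermitian element of the algebra is dominated by some q^* q.
   For operators u_n commuting with Q one has |q (u_m - u_n) x| =
   |(u_m - u_n) (q x)|, so pointwise norm-Cauchy sequences in the commutant of Q
   already converge in the graph topology; this gives uniform completeness
   for every dominant Q.  If all q in Q are invertible and 1 <= a in the algebra,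
   choose h in Q with a <= h and put k = h^-1: the partial sums of
   sum_j (1 - k a)^j k increase and are bounded by 1, hence converge strongly,
   and the limit is a^-1.  Conversely q^* q is coercive, so it is invertible in
   a Su*-algebra, and so is the normal element q. *)
Require Import Defs.
From mathcomp Require Import all_boot all_order all_algebra.
From mathcomp Require Import sesquilinear complex.
From mathcomp Require Import all_classical all_reals.
From mathcomp Require Import ereal topology normedtype sequences.
Set Implicit Arguments.
Unset Strict Implicit.
Unset Printing Implicit Defensive.
Import Order.TTheory GRing.Theory Num.Theory.
Import numFieldNormedType.Exports.
Local Open Scope classical_set_scope.
Local Open Scope ring_scope.

Local Arguments leH_herm {R s a b}.
Local Arguments leH_add {R s a b c}.
Local Arguments leH_trans {R s b a c}.
Local Arguments leH_conj {R s a b} d.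

(** * Sequential form of completeness in the graph topology *)

(** An entourage of the supremum contains a finite intersection of entourages of the components, and
    a filter is stable under finite intersections. *)
Lemma cauchy_sup (T : choiceType) (I : Type) (Tc : I -> Uniform T)
    (F : set_system T) : Filter F ->
  (forall i, @cauchy (Uniform.Pack (Tc i)) F) -> @cauchy (sup_topology Tc) F.
Proof.
move=> FF Fc E [_ [B _ <-] BE]; apply: filterS BE _.
apply: filter_bigI => -[[i X] Xe] _ /=.
by move/asboolP: (Xe) => /= /Fc.
Qed.

(** Restates closedness through sequences and seminorms; the filter used is the image of [\oo] under
    [v], and its tails witness the Cauchy condition. *)
Lemma Ostar_closed_cvg (R : realType) (D : lmodType R[i])
    (form : {dot D for @Num.conj R[i]}) (S : set (Lstar form)) (v : nat -> D) :
  Ostar_closed S ->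
  (forall b : Lstar form, S b -> leH 0 b -> forall e : R, 0 < e -> exists N,
     forall m n, (N <= m)%N -> (N <= n)%N -> graph_seminorm b (v m - v n) < e) ->
  exists x : D, forall b : Lstar form, S b -> leH 0 b -> forall e : R, 0 < e ->
    exists N, forall n, (N <= n)%N -> graph_seminorm b (x - v n) < e.
Proof.
move=> Sc vc.
have [|x vx] := Sc ((v : nat -> graph_space S) @ \oo) _.
  apply: cauchy_sup => -[[b b0] /= Sb].
  apply/(@cauchy_ballP R (seminorm_space (exist _ b b0))) => e e0.
  have [N vN] := vc b Sb b0 e e0.
  exists ([set y | exists2 n, (N <= n)%N & v n = y],
          [set y | exists2 n, (N <= n)%N & v n = y]) => /=.
    by split; exists N => // n /= Nn; exists n.
  by move=> [_ _] [/= [m Nm <-] [n Nn <-]]; exact: vN.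
exists x => b Sb b0 e e0.
have /cvg_sup /(_ (exist _ (exist _ b b0) Sb)) vxb := vx.
have [N _ vN] := vxb _ (nbhsx_ballx (x : seminorm_space (exist _ b b0)) e e0).
by exists N.
Qed.

(** * Order calculus in ordered star-algebras *)

Section OrderedStarAlgebraTheory.
Variables (R : realType) (A : ordStarAlgType R).
Implicit Types a b c d : A.

Lemma leH0_herm a : leH 0 a -> is_hermitian a.
Proof. by case/leH_herm. Qed.

Lemma starB a b : (a - b)^*s = a^*s - b^*s.
Proof. by rewrite starD -!cscaleN1 starZ rmorphN rmorph1. Qed.

Lemma hermB a b : is_hermitian a -> is_hermitian b -> is_hermitian (a - b).
Proof. by rewrite /is_hermitian starB => -> ->. Qed.

Lemma hermN a : is_hermitian a -> is_hermitian (- a).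
Proof. by rewrite -sub0r; apply: hermB; exact: star0. Qed.

Lemma leH_sub_ge0 a b : leH a b -> leH 0 (b - a).
Proof.
move=> ab; have [ha _] := leH_herm ab.
by rewrite -(subrr a); apply: leH_add => //; exact: hermN.
Qed.

Lemma sub_ge0_leH a b : is_hermitian a -> leH 0 (b - a) -> leH a b.
Proof. by move=> ha /(leH_add ha); rewrite add0r subrK. Qed.

Lemma leH0_add a b : leH 0 a -> leH 0 b -> leH 0 (a + b).
Proof.
move=> a0 b0; apply: (leH_trans b0); rewrite -{1}[b]add0r.
exact: leH_add (leH0_herm b0) a0.
Qed.

Lemma leH0_conj a d : leH 0 a -> leH 0 (d^*s * a * d).
Proof. by move=> /(leH_conj d); rewrite mulr0 mul0r. Qed.

Lemma leH0_sqr d : leH 0 (d^*s * d).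
Proof. by have := leH0_conj d (@leH_01 R A); rewrite mulr1. Qed.

Lemma leH0_sum (F : nat -> A) n :
  (forall i, leH 0 (F i)) -> leH 0 (\sum_(i < n) F i).
Proof.
move=> F0; elim/big_ind : _ => // [|a b]; last exact: leH0_add.
by apply: leH_refl; exact: star0.
Qed.

(** As [c] commutes with [1 - c], the difference [c - c * c] equals
    [(1 - c) c (1 - c) + c (1 - c) c], a sum of two conjugates of positive elements. *)
Lemma sqr_leH c : leH 0 c -> leH c 1 -> leH (c * c) c.
Proof.
move=> c0 c1; have hc := leH0_herm c0; have h1c := hermB (star1 A) hc.
apply: sub_ge0_leH; first by rewrite /is_hermitian starM hc.
have -> : c - c * c = (1 - c)^*s * c * (1 - c) + c^*s * (1 - c) * c.
  rewrite h1c hc.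
  have -> : (1 - c) * c * (1 - c) = (1 - c) * ((1 - c) * c).
    by rewrite -mulrA; congr (_ * _); rewrite mulrBl mulrBr mulr1 mul1r.
  have -> : c * (1 - c) * c = c * ((1 - c) * c) by rewrite mulrA.
  by rewrite -mulrDl subrK mul1r mulrBl mul1r.
by apply: leH0_add; apply: leH0_conj => //; exact: leH_sub_ge0.
Qed.

(** Rests on the identity [1 - c = (1 - c)^2 + (c - c^2)]. *)
Lemma leH1_sqr c : leH 0 c -> leH (c * c) c -> leH c 1.
Proof.
move=> c0 cc; have hc := leH0_herm c0; have h1c := hermB (star1 A) hc.
apply: sub_ge0_leH => //.
have -> : 1 - c = (1 - c)^*s * (1 - c) + (c - c * c).
  have -> : c - c * c = c * (1 - c) by rewrite mulrBr mulr1.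
  by rewrite h1c -mulrDl subrK mul1r.
by apply: leH0_add; [exact: leH0_sqr|exact: leH_sub_ge0].
Qed.
End OrderedStarAlgebraTheory.

(** * Monotone Neumann sums bounded by the unit *)

(* The terms [t^j k], with [t = 1 - k a] and [k = h^-1], are positive because
   [t k = k (h - a) k]. *)
Section NeumannSeries.
Variables (R : realType) (A : ordStarAlgType R) (a h k : A).
Hypotheses (k_ge0 : leH 0 k) (hk : h * k = 1).
Hypotheses (ka : k * a = a * k) (a_ge1 : leH 1 a) (ah : leH a h).

Definition neumann_ratio : A := 1 - k * a.
Local Notation t := neumann_ratio.

(** Since [1 - t = k * a], the full geometric series is formally [(k a)^-1 k = a^-1]. *)
Definition neumann_sum n : A := \sum_(j < n) t ^+ j * k.
Local Notation b := neumann_sum.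

Let hermk : is_hermitian k. Proof. exact: leH0_herm. Qed.
Let herma : is_hermitian a. Proof. by have [] := leH_herm ah. Qed.
Let hermt : is_hermitian t.
Proof.
by apply: hermB; [exact: star1|rewrite /is_hermitian starM hermk herma ka].
Qed.
Let commtk : GRing.comm t k.
Proof.
by rewrite /GRing.comm /t mulrBl mulrBr mul1r mulr1 mulrA -[k * a * k]mulrA -ka mulrA.
Qed.

Lemma neumann_term_ge0 j : leH 0 (t ^+ j * k).
Proof.
(* Conjugation by [t] raises the exponent by two, so the induction carries two consecutive
   exponents. *)
suff : leH 0 (t ^+ j * k) /\ leH 0 (t ^+ j.+1 * k) by case.
elim: j => [|j [IH1 IH2]]; split=> //.
- by rewrite expr0 mul1r.
- have -> : t ^+ 1 * k = k^*s * (h - a) * k.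
    have -> : k^*s * (h - a) * k = k - k * a * k.
      by rewrite hermk -mulrA (mulrBl _ h) hk mulrBr mulr1 mulrA.
    by rewrite expr1 mulrBl mul1r.
  exact/leH0_conj/leH_sub_ge0.
- have -> : t ^+ j.+2 * k = t^*s * (t ^+ j * k) * t.
    by rewrite hermt exprSr exprS -!mulrA commtk.
  exact: leH0_conj.
Qed.

Lemma neumann_sum_ge0 n : leH 0 (b n).
Proof. exact: (leH0_sum (F := fun j => t ^+ j * k)) neumann_term_ge0. Qed.

Lemma neumann_sum_le m n : (m <= n)%N -> leH (b m) (b n).
Proof.
move=> mn; apply: sub_ge0_leH; first exact/leH0_herm/neumann_sum_ge0.
rewrite /b -(subnKC mn) big_split_ord /= addrAC subrr add0r.
by apply: (leH0_sum (F := fun i => t ^+ (m + i) * k)) => j; exact: neumann_term_ge0.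
Qed.

(** In this form the recursion can be passed to the strong limit [w], where it forces
    [k (1 - a w) = 0]. *)
Lemma neumann_sumS n : b n.+1 = b n + k * (1 - a * b n).
Proof.
rewrite /b big_ord_recl /= expr0 mul1r.
under eq_bigr => i _ do rewrite /bump /= add1n exprS -mulrA.
by rewrite -mulr_sumr /t mulrBl mul1r mulrBr mulr1 mulrA addrCA.
Qed.

Lemma mul_neumann_sum n : a * b n = 1 - t ^+ n.
Proof.
have ks : GRing.comm k (\sum_(i < n) t ^+ i).
  by apply: commr_sum => i _; exact/commrX/commr_sym.
rewrite /b -mulr_suml -ks mulrA -ka.
by rewrite -[RHS]opprB subrX1 -mulNr opprB subKr.
Qed.

(** Here [b^2 <= b a b] because [1 <= a], and [b a b = b - b t^n <= b] because [b t^n] is a sum of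
    positive terms [t^(j+n) k]; then [leH1_sqr] applies. *)
Lemma neumann_sum_le1 n : leH (b n) 1.
Proof.
have b0 := neumann_sum_ge0 n; have hb := leH0_herm b0.
apply: leH1_sqr => //.
apply: leH_trans (_ : leH (b n * a * b n) _).
  by have := leH_conj (b n) a_ge1; rewrite mulr1 hb.
apply: sub_ge0_leH.
  by rewrite /is_hermitian !starM hb herma mulrA.
rewrite -mulrA mul_neumann_sum mulrBr mulr1 opprB addrCA subrr addr0.
rewrite /b mulr_suml.
apply: (leH0_sum (F := fun i => t ^+ i * k * t ^+ n)) => j.
rewrite -mulrA (commrX n (commr_sym commtk)) mulrA -exprD.
exact: neumann_term_ge0.
Qed.

(** The difference lies between 0 and 1, so [sqr_leH] applies. It bounds the squared norm of an
    increment by an increment of quadratic forms. *)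
Lemma neumann_sum_diff_sqr m n : (m <= n)%N ->
  leH ((b n - b m) * (b n - b m)) (b n - b m).
Proof.
move=> mn; apply: sqr_leH; first exact/leH_sub_ge0/neumann_sum_le.
apply: leH_trans (neumann_sum_le1 n).
have := leH_add (leH0_herm (leH_sub_ge0 (neumann_sum_le mn))) (neumann_sum_ge0 m).
by rewrite add0r addrCA subrr addr0.
Qed.

Lemma neumann_sum_comm c n :
  GRing.comm c a -> GRing.comm c k -> GRing.comm c (b n).
Proof.
move=> ca ck; apply: commr_sum => i _; apply: commrM => //; apply: commrX.
by apply: commrB; [exact: commr1|exact: commrM].
Qed.
End NeumannSeries.

(** * Real inner product, operator bounds and strong limits *)

Section RealInnerProduct.
Variables (R : realType) (D : lmodType R[i]).
Variable form : {dot D for @Num.conj R[i]}.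
Local Notation L := (Lstar form).
Implicit Types (a b : L) (x y z : D).

(** The real part already separates vectors and decides the order between Hermitian operators, so
    limits can be taken in [R]. *)
Definition rinner x y : R := complex.Re (inner form x y).
Definition inorm x : R := graph_seminorm (1 : L) x.

Local Notation "<| x , y |>" := (rinner x y) (x at level 69, y at level 69).
Local Notation "|` x |" := (inorm x) (x at level 69).

Lemma rinnerC x y : <|x, y|> = <|y, x|>.
Proof. by rewrite /rinner inner_conj; case: (inner form y x). Qed.
Lemma rinnerDr x y z : <|x, y + z|> = <|x, y|> + <|x, z|>.
Proof.
by rewrite /rinner innerDr; case: (inner form x y) (inner form x z) => [? ?] [].
Qed.
Lemma rinner0r x : <|x, 0|> = 0.
Proof. by rewrite /rinner inner0r. Qed.
Lemma rinnerNr x y : <|x, - y|> = - <|x, y|>.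
Proof. by rewrite /rinner innerNr; case: (inner form x y). Qed.
Lemma rinnerBr x y z : <|x, y - z|> = <|x, y|> - <|x, z|>.
Proof. by rewrite rinnerDr rinnerNr. Qed.
Lemma rinnerZr (k : R[i]) x y : <|x, k *: y|> = <|Num.conj k *: x, y|>.
Proof. by rewrite /rinner innerZl innerZr conjCK. Qed.
Lemma rinnerZr_real (r : R) x y : <|x, rtoC r *: y|> = r * <|x, y|>.
Proof.
by rewrite /rinner innerZr; case: (inner form x y) => ? ? /=; rewrite mul0r subr0.
Qed.
Lemma rinner_op a x y : <|a x, y|> = <|x, op a^*s y|>.
Proof. exact: (congr1 (@complex.Re R) (LadjPr a x y)). Qed.

Lemma inorm_ge0 x : 0 <= |`x|.
Proof. exact: sqrtr_ge0. Qed.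
Lemma inorm_sqr x : |`x| ^+ 2 = <|x, x|>.
Proof. exact/sqr_sqrtr/(graph_form_ge0 (leH_01 (s := L))). Qed.
Lemma inormN x : |`- x| = |`x|.
Proof. exact: graph_seminormN. Qed.
Lemma inormD x y : |`x + y| <= |`x| + |`y|.
Proof. exact: (graph_seminormD (leH_01 (s := L))). Qed.

(** Cauchy-Schwarz: the squared norm of [s x + t y] is a nonnegative quadratic form in the reals [s]
    and [t], to which [real_form_bound] applies. *)
Lemma rinner_le x y : <|x, y|> <= |`x| * |`y|.
Proof.
have : 2 * <|x, y|> <= 2 * |`x| * |`y|.
  apply: real_form_bound => [||s t]; [exact: inorm_ge0|exact: inorm_ge0|].
  have := graph_form_ge0 (leH_01 (s := L)) (rtoC s *: x + rtoC t *: y).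
  rewrite graph_formZD !inorm_sqr.
  rewrite -[complex.Re (inner form x (op 1 y))]/<|x, y|>.
  by rewrite -[complex.Re (inner form y (op 1 x))]/<|y, x|> (rinnerC y x) -mulr2n mulr_natl.
by rewrite -mulrA ler_pM2l.
Qed.

Lemma normr_rinner_le x y : `|<|x, y|>| <= |`x| * |`y|.
Proof.
by rewrite ler_norml rinner_le andbT lerNl -rinnerNr -(inormN y) rinner_le.
Qed.

Lemma rinner_injr x y : (forall z, <|z, x|> = <|z, y|>) -> x = y.
Proof.
move=> xy; apply/eqP; rewrite -subr_eq0; apply/eqP/(@inner_eq0 _ _ form).
have := inner_ge0 form (x - y); rewrite lecE => /andP[/eqP im0 _].
have : <|x - y, x - y|> = 0 by rewrite rinnerBr xy subrr.
by rewrite /rinner; case: (inner form _ _) im0 => ? ? /= -> ->.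
Qed.

Lemma inner_hermitian_Im a x : is_hermitian a ->
  complex.Im (inner form x (a x)) = 0.
Proof.
move=> ha; have := inner_conj form x (a x); rewrite -[a in RHS]ha.
rewrite op_star; case: (inner form x (a x)) => r s [] /= /eqP.
by rewrite -addr_eq0 -mulr2n mulrn_eq0 => /eqP.
Qed.

Lemma leH_rinnerP a b : leH a b <->
  [/\ is_hermitian a, is_hermitian b & forall x, <|x, a x|> <= <|x, b x|>].
Proof.
split=> [[ha hb ab]|[ha hb ab]]; split=> // x.
  by have := ab x; rewrite lecE => /andP[].
by rewrite lecE !inner_hermitian_Im // eqxx; exact: ab.
Qed.

Lemma rinner_star_mul a x : <|x, op (a^*s * a) x|> = |`a x| ^+ 2.
Proof. by rewrite inorm_sqr rinner_op. Qed.

Lemma leH_star_mulP a b :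
  leH (a^*s * a) (b^*s * b) <-> forall x, |`a x| <= |`b x|.
Proof.
split=> [/leH_rinnerP[_ _ ab] x|ab].
  by have := ab x; rewrite !rinner_star_mul ler_pXn2r ?nnegrE ?inorm_ge0.
apply/leH_rinnerP; split=> [||x]; try by rewrite /is_hermitian starM starK.
by rewrite !rinner_star_mul ler_pXn2r ?nnegrE ?inorm_ge0.
Qed.

Lemma conjc_real (r : R) : Num.conj (rtoC r) = rtoC r.
Proof. by rewrite -[LHS]/(conjc _) /= oppr0. Qed.

Lemma inormZ_real (r : R) x : 0 <= r -> |`rtoC r *: x| = r * |`x|.
Proof.
move=> r0; apply/eqP; rewrite -(eqrXn2 (n := 2)) ?mulr_ge0 ?inorm_ge0 //.
by rewrite exprMn !inorm_sqr rinnerZr_real rinnerC rinnerZr_real mulrA expr2.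
Qed.

(** For positive [l] the order condition is the one in [norm_oo], so the uniform metric can be
    handled by pointwise estimates. *)
Lemma star_mul_leH_scaleP a (l : R) : 0 <= l ->
  leH (a^*s * a) (rtoC (l ^+ 2) *c 1) <-> forall x, |`a x| <= l * |`x|.
Proof.
move=> l0; have -> : rtoC (l ^+ 2) *c 1 = (rtoC l *c 1)^*s * (rtoC l *c 1) :> L.
  by rewrite starZ star1 conjc_real -cscaleAl mul1r cscaleA -rmorphM expr2.
rewrite leH_star_mulP.
by split=> al x; have := al x; rewrite -[op (_ *c 1) x]/(rtoC l *: x) inormZ_real.
Qed.

(** Cauchy-Schwarz on [<x, a a^* x>] bounds the square of the norm of [a^* x] by [l] times the norms
    of [x] and [a^* x]; a nonzero factor cancels. *)
Lemma inorm_star_le a (l : R) : 0 <= l -> (forall x, |`a x| <= l * |`x|) ->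
  forall x, |`op a^*s x| <= l * |`x|.
Proof.
move=> l0 al x; have [->|ax0] := eqVneq (|`op a^*s x|) 0.
  by rewrite mulr_ge0 ?inorm_ge0.
have axp : 0 < |`op a^*s x| by rewrite lt_def ax0 inorm_ge0.
rewrite -(ler_pM2l axp) -expr2 inorm_sqr rinner_op starK.
apply: (le_trans (rinner_le _ _)); rewrite mulrC (mulrCA _ l) mulrA.
by rewrite ler_wpM2r ?inorm_ge0.
Qed.

Definition strong_cauchy (v : nat -> D) : Prop := forall e : R, 0 < e ->
  exists N, forall m n, (N <= m)%N -> (N <= n)%N -> |`v m - v n| < e.

Definition strong_lim (v : nat -> D) x : Prop := forall e : R, 0 < e ->
  exists N, forall n, (N <= n)%N -> |`x - v n| < e.

(** Follows from Cauchy-Schwarz. Identities between strong limits thereby reduce to uniqueness of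
    limits in [R], tested against every [z]. *)
Lemma strong_lim_rinner v x z : strong_lim v x ->
  <|z, v n|> @[n --> \oo] --> <|z, x|>.
Proof.
move=> vx; apply/cvgrPdist_lt => e e0.
have z0 : 0 < |`z| + 1 by rewrite ltr_wpDl ?inorm_ge0.
have [N vN] := vx (e / (|`z| + 1)) (divr_gt0 e0 z0).
exists N => // n /= /vN; rewrite ltr_pdivlMr // => xvn.
rewrite -rinnerBr; apply: le_lt_trans xvn.
apply: le_trans (normr_rinner_le _ _) _.
by rewrite mulrC ler_wpM2l ?inorm_ge0 // lerDl.
Qed.

Lemma strong_lim_inorm_le v x (C : R) : strong_lim v x ->
  (exists N, forall n, (N <= n)%N -> |`v n| <= C) -> |`x| <= C.
Proof.
move=> vx [M vC]; apply/ler_addgt0Pl => e e0; have [N vN] := vx e e0.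
rewrite -(subrK (v (maxn M N)) x); apply: le_trans (inormD _ _) _.
by rewrite lerD ?vC ?ltW ?vN ?leq_maxl ?leq_maxr.
Qed.
End RealInnerProduct.

Arguments strong_lim_rinner {R D form v x}.

(** * Strong limits inside the commutant of [Q] *)

Section DownAlgebra.
Variables (R : realType) (D : lmodType R[i]).
Variable form : {dot D for @Num.conj R[i]}.
Local Notation L := (Lstar form).
Variable Q : set L.
Hypothesis Q_dominant : dominant Q.
Hypothesis QO : Ostar_algebra (down_algebra Q).
Local Notation S := (down_algebra Q).
Local Notation "<| x , y |>" := (rinner form x y) (x at level 69, y at level 69).
Local Notation "|` x |" := (inorm form x) (x at level 69).
Implicit Types (a b q : L) (x y z : D).

Lemma dominant_down q : Q q -> S q.
Proof.
have [[qn qc _ _] _] := Q_dominant => Qq; split; first by move=> r Qr; exact: qc.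
by exists q => //; rewrite -qn //; split; apply: leH_refl;
  rewrite /is_hermitian starM starK.
Qed.

Lemma dominant_inorm_le q : Q q ->
  exists2 l : R, 1 <= l & forall x, |`x| <= l * |`op q x|.
Proof.
have [_ [Qcoer _ _]] := Q_dominant => /Qcoer[e e0 /leH_rinnerP[_ _ qe]].
(* Coercivity gives the factor [e^-1] for squared norms. The constant [1 + e^-1] has a square above
   it, and being at least 1 it may rescale elements of [Q]. *)
have l1 : 1 <= 1 + e^-1 by rewrite lerDl invr_ge0 ltW.
exists (1 + e^-1) => // x; have l0 := le_trans ler01 l1.
have := qe x; rewrite rinner_star_mul -[op (rtoC e *c 1) x]/(rtoC e *: x).
rewrite rinnerZr_real -inorm_sqr mulrC -ler_pdivlMr // mulrC => xq.
rewrite -(ler_pXn2r (n := 2)) ?nnegrE ?mulr_ge0 ?inorm_ge0 //.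
apply: le_trans xq _; rewrite exprMn ler_wpM2r ?sqr_ge0 // expr2.
by apply: le_trans (_ : 1 + e^-1 <= _); rewrite ?lerDr // ler_peMr.
Qed.

(* [<x, a x> <= |x| |q x|], and [|x|] is absorbed since [q^* q] is coercive. *)
Lemma down_algebra_le_star_mul a : S a -> is_hermitian a ->
  exists2 q, Q q & leH a (q^*s * q).
Proof.
have [_ [_ Qscale _]] := Q_dominant.
move=> [_ [q Qq [/leH_star_mulP aq _]]] ha; have [l l1 ql] := dominant_inorm_le Qq.
exists (rtoC l *c q); first exact: Qscale.
apply/leH_rinnerP; split=> // [|x]; first by rewrite /is_hermitian starM starK.
rewrite rinner_star_mul.
rewrite -[op (_ *c q) x]/(rtoC l *: op q x) inormZ_real; last exact: le_trans l1.
apply: le_trans (rinner_le _ _ _) _; rewrite expr2.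
apply: ler_pM (ql x) _; rewrite ?inorm_ge0 //.
by apply: le_trans (aq x) _; rewrite ler_peMl ?inorm_ge0.
Qed.

Hypothesis Q_closed : Ostar_closed S.

Lemma commutant_op a q x : commutant Q a -> Q q -> a (op q x) = op q (a x).
Proof. by move=> aQ /aQ /(congr1 (fun c : L => c x)). Qed.

Lemma down_algebra_strong_complete (u : nat -> L) :
  (forall n, commutant Q (u n)) -> (forall x, strong_cauchy form (fun n => u n x)) ->
  forall x, exists y, strong_lim form (fun n => u n x) y.
Proof.
move=> uQ uc x.
have [b Sb b0 e e0|y uy] := Ostar_closed_cvg (v := fun n => u n x) Q_closed.
  have [q Qq bq] := down_algebra_le_star_mul Sb (leH0_herm b0).
  have [N uN] := uc (op q x) e e0; exists N => m n Nm Nn.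
  apply: le_lt_trans (uN m n Nm Nn).
  rewrite (commutant_op x (uQ m) Qq) (commutant_op x (uQ n) Qq) -(opN q) -(opDr q).
  rewrite -(ler_pXn2r (n := 2)) ?nnegrE ?inorm_ge0 ?sqrtr_ge0 //.
  rewrite sqr_sqrtr ?graph_form_ge0 // -rinner_star_mul.
  by have /leH_rinnerP[_ _] := bq; exact.
(* The unit belongs to the algebra and its graph seminorm is the norm, so graph convergence contains
   norm convergence. *)
by exists y => e e0; have [S1 _ _ _ _] := QO; exact: uy leH_01 _ e0.
Qed.

(** The limit of the adjoints supplies the adjoint that makes the limit operator an element of
    [Lstar]. *)
Lemma down_algebra_strong_limit (u : nat -> L) :
  (forall n, commutant Q (u n)) -> (forall n, commutant Q (u n)^*s) ->
  (forall x, strong_cauchy form (fun n => u n x)) ->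
  (forall x, strong_cauchy form (fun n => op (u n)^*s x)) ->
  exists w : L, [/\ commutant Q w,
    forall x, strong_lim form (fun n => u n x) (w x) &
    forall x, strong_lim form (fun n => op (u n)^*s x) (op w^*s x)].
Proof.
move=> uQ uQ' uc uc'.
have [f uf] := choice (down_algebra_strong_complete uQ uc).
have [g ug] := choice (down_algebra_strong_complete uQ' uc').
have lim_linear (a : nat -> L) (h : D -> D) :
    (forall x, strong_lim form (fun n => a n x) (h x)) -> linear h.
  move=> ah k x y; apply: (@rinner_injr _ _ form) => z.
  have lz := strong_lim_rinner z (ah (k *: x + y)).
  apply: cvg_unique lz _ => //.
  rewrite (_ : (fun n => <|z, a n (k *: x + y)|>) =
      (fun n => <|Num.conj k *: z, a n x|> + <|z, a n y|>)); last first.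
    by apply/funext => n; rewrite opDr opZ rinnerDr rinnerZr.
  rewrite rinnerDr rinnerZr.
  by apply: cvgD; exact: strong_lim_rinner.
have rgf x y : <|g x, y|> = <|x, f y|>.
  rewrite [LHS]rinnerC; apply: cvg_unique (strong_lim_rinner y (ug x)) _ => //.
  rewrite (_ : (fun n => _) = (fun n => <|x, u n y|>)).
    exact: strong_lim_rinner.
  by apply/funext => n; rewrite -rinner_op rinnerC.
have gf : is_adjoint form g f.
  (* The real identity at [i y] yields the equality of imaginary parts. *)
  move=> x y; have := rgf x y; have := rgf x (Complex 0 1 *: y).
  rewrite (GRing.scalable_linear (lim_linear _ _ uf)) /rinner !innerZr.
  case: (inner form (g x) y) (inner form x (f y)) => [r s] [r' s'] /=.
  by rewrite !mul0r !mul1r !sub0r => /oppr_inj -> ->.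
have fP : adjointable form f.
  by apply/asboolP; split; [exact: lim_linear uf|exists g => //; exact: lim_linear ug].
pose w : L := exist _ f fP.
have wg x : op w^*s x = g x.
  by apply: (@inner_injl _ _ form) => y; rewrite op_star gf.
exists w; split=> // [q Qq|x]; last by rewrite wg.
(* Since [q] may be unbounded, it is moved onto the test vector as [q^*], where the strong
   convergence of [u n x] applies. *)
apply: opP => x; apply: (@rinner_injr _ _ form) => z.
apply: cvg_unique (strong_lim_rinner z (uf (op q x))) _ => //.
rewrite (_ : (fun n => _) = (fun n => <|op q^*s z, u n x|>)).
  rewrite opM -[q in op q (w x)]starK -rinner_op; exact: strong_lim_rinner.
by apply/funext => n; rewrite (commutant_op x (uQ n) Qq) rinner_op starK.
Qed.
End DownAlgebra.

(** * The uniform distance as an order bound *)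

Section UniformDistance.
Variables (R : realType) (A : ordStarAlgType R).
Implicit Types a b : A.

Let min_norm_oo a : (0 <= Order.min (norm_oo a) 1 <= 1)%E.
Proof.
rewrite ge_min lexx orbT andbT le_min lee01 andbT.
by apply: le_ereal_inf_tmp => _ [l [l0 _] <-]; rewrite lee_fin ltW.
Qed.

Let min_norm_oo_fin a : (Order.min (norm_oo a) 1)%E \is a fin_num.
Proof.
have /andP[m0 m1] := min_norm_oo a.
by rewrite ge0_fin_numE //; exact: le_lt_trans m1 (ltry _).
Qed.

Lemma dist_oo_ge0 a b : 0 <= dist_oo a b.
Proof. by apply: fine_ge0; case/andP: (min_norm_oo (a - b)). Qed.

(** For [e <= 1] the truncation at 1 in [dist_oo] is inactive, and the infimum yields an admissible
    [l]. *)
Lemma dist_oo_lt a b (e : R) : e <= 1 -> dist_oo a b < e ->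
  exists2 l : R, 0 < l < e & leH ((a - b)^*s * (a - b)) (rtoC (l ^+ 2) *c 1).
Proof.
move=> e1; rewrite -lte_fin fineK // gt_min => /orP[|].
  by move/ereal_inf_lt => [_ [l [l0 al] <-]]; rewrite lte_fin => le; exists l => //; rewrite l0.
by rewrite lte_fin ltNge e1.
Qed.

Lemma dist_oo_le a b (l : R) : 0 < l ->
  leH ((a - b)^*s * (a - b)) (rtoC (l ^+ 2) *c 1) -> dist_oo a b <= l.
Proof.
move=> l0 al; rewrite -lee_fin fineK // ge_min; apply/orP; left.
by apply: ereal_inf_lbound; exists l.
Qed.

Lemma sub_algebra_leH_scale (T : set A) (HT : star_subalgebra T)
    (a b : sub_algebra HT) (k : R[i]) :
  leH ((a - b)^*s * (a - b)) (k *c 1) <->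
  leH ((val a - val b)^*s * (val a - val b)) (k *c 1).
Proof. by []. Qed.
End UniformDistance.

(** * Uniform completeness, and inverses of elements above the unit *)

Section InvertibleDominant.
Variables (R : realType) (D : lmodType R[i]).
Variable form : {dot D for @Num.conj R[i]}.
Local Notation L := (Lstar form).
Variable Q : set L.
Hypothesis Q_dominant : dominant Q.
Hypothesis QO : Ostar_algebra (down_algebra Q).
Hypothesis Q_closed : Ostar_closed (down_algebra Q).
Local Notation S := (down_algebra Q).
Local Notation "<| x , y |>" := (rinner form x y) (x at level 69, y at level 69).
Local Notation "|` x |" := (inorm form x) (x at level 69).
Implicit Types (a b q : L) (x y z : D).

Lemma down_algebra_uniformly_complete : uniformly_complete (sub_algebra QO).
Proof.
move=> u uc; pose v n : L := val (u n).
have vQ n : commutant Q (v n).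
  by have [] : S (v n) by exact/set_mem/(valP (u n)).
have vQ' n : commutant Q (v n)^*s.
  by have [_ _ _ _ /(_ (v n))] := QO; case=> //; exact/set_mem/(valP (u n)).
have vc (e : R) : 0 < e -> exists N, forall m n, (N <= m)%N -> (N <= n)%N ->
    forall x, |`v m x - v n x| <= e * |`x|.
  (* The cap at 1 meets the condition of [dist_oo_lt]. *)
  move=> e0; have e'0 : 0 < Order.min e 1 by rewrite lt_min e0 ltr01.
  have [N uN] := uc _ e'0; exists N => m n Nm Nn x.
  have := uN m n Nm Nn; rewrite -/(dist_oo _ _).
  move/dist_oo_lt => []; first by rewrite ge_min lexx orbT.
  move=> l /andP[l0 le] /sub_algebra_leH_scale /(star_mul_leH_scaleP (v m - v n) (ltW l0)) /(_ x) h.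
  apply: le_trans h _; rewrite ler_wpM2r ?inorm_ge0 //.
  by move: le; rewrite lt_min => /andP[/ltW].
have vc' (e : R) : 0 < e -> exists N, forall m n, (N <= m)%N -> (N <= n)%N ->
    forall x, |`op (v m)^*s x - op (v n)^*s x| <= e * |`x|.
  move=> e0; have [N vN] := vc e e0; exists N => m n Nm Nn x.
  have := inorm_star_le (a := v m - v n) (ltW e0) (vN m n Nm Nn) x.
  by rewrite starB.
have pc (f : nat -> L) : (forall e : R, 0 < e -> exists N, forall m n, (N <= m)%N ->
    (N <= n)%N -> forall x, |`f m x - f n x| <= e * |`x|) ->
    forall x, strong_cauchy form (fun n => f n x).
  move=> fc x e e0; have x0 : 0 < |`x| + 1 by rewrite ltr_wpDl ?inorm_ge0.
  have [N fN] := fc (e / (|`x| + 1)) (divr_gt0 e0 x0).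
  exists N => m n Nm Nn; apply: le_lt_trans (fN m n Nm Nn x) _.
  by rewrite mulrAC ltr_pdivrMr // ltr_pM2l // ltrDl.
have [w [wQ vw vw']] := down_algebra_strong_limit Q_dominant QO Q_closed vQ vQ'
  (pc _ vc) (pc (fun n => (v n)^*s) vc').
(* Letting [m] tend to infinity in the uniform Cauchy estimate makes the strong convergence
   uniform. *)
have wv (e : R) : 0 < e -> exists N, forall n, (N <= n)%N ->
    forall x, |`w x - v n x| <= e * |`x|.
  move=> e0; have [N vN] := vc e e0; exists N => n Nn x.
  apply: (@strong_lim_inorm_le _ _ _ (fun m => v m x - v n x)).
    move=> d d0; have [M vM] := vw x d d0; exists M => m /vM.
    by rewrite opprB addrA subrK.
  by exists N => m Nm; exact: vN.
have Sw : S w.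
  split=> //; have [N /(_ N (leqnn N)) wN] := wv 1 ltr01.
  have [_ [q Qq [vq v'q]]] : S (v N) by exact/set_mem/(valP (u N)).
  have [l l1 ql] := dominant_inorm_le Q_dominant Qq.
  have l0 : 0 <= l by exact: le_trans l1.
  (* The operator [w] is within distance 1 of [v N], which is dominated by [q], and the norm of [x]
     is at most [l] times that of [q x]; the sum gives [1 + l]. *)
  exists (rtoC (1 + l) *c q).
    by have [_ [_ Qs _]] := Q_dominant; apply: Qs => //; rewrite lerDl.
  have bound (b c : L) : leH (c^*s * c) (q^*s * q) ->
      (forall x, |`b x - c x| <= 1 * |`x|) ->
      leH (b^*s * b) ((rtoC (1 + l) *c q)^*s * (rtoC (1 + l) *c q)).
    move=> /leH_star_mulP cq bc; apply/leH_star_mulP => x.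
    rewrite -[op (_ *c q) x]/(rtoC (1 + l) *: op q x) inormZ_real ?addr_ge0 //.
    rewrite -(subrK (c x) (b x)); apply: le_trans (inormD _ _ _) _.
    rewrite mulrDl mul1r addrC lerD ?cq //.
    by apply: le_trans (bc x) _; rewrite mul1r.
  split; first exact: bound vq wN.
  rewrite -{1}[w]starK; apply: (bound _ (v N)^*s); first by rewrite starK.
  move=> x; have := inorm_star_le (a := w - v N) ler01 wN x.
  by rewrite starB.
exists (Sub w (mem_set Sw)); apply/cvgrPdist_lt => e e0.
(* Halving compensates for the non-strict bound in [dist_oo_le]. *)
have e20 : 0 < e / 2 by rewrite divr_gt0.
have [N wN] := wv _ e20; exists N => // n /= Nn.
rewrite sub0r normrN ger0_norm ?dist_oo_ge0 //.
apply: le_lt_trans (_ : e / 2 < e); last by rewrite ltr_pdivrMr // mulr_natr mulr2n ltrDl.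
apply: dist_oo_le => //; apply/sub_algebra_leH_scale.
apply/(star_mul_leH_scaleP (v n - w) (ltW e20)) => x.
by rewrite -[op (v n - w) x]/(v n x - w x) -inormN opprB wN.
Qed.

Lemma strong_lim_unique (v : nat -> D) x y :
  strong_lim form v x -> strong_lim form v y -> x = y.
Proof.
move=> vx vy; apply: (@rinner_injr _ _ form) => z.
by apply: cvg_unique (strong_lim_rinner z vx) _ => //; exact: strong_lim_rinner.
Qed.

(** The reals [<x, b_n x>] increase and stay below [<x, x>], hence converge, and their increments
    dominate the squared norms of [(b_n - b_m) x]. *)
Lemma neumann_sum_strong_cauchy (a h k : L) x : leH 0 k -> h * k = 1 ->
  k * a = a * k -> leH 1 a -> leH a h ->
  strong_cauchy form (fun n => op (neumann_sum a k n) x).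
Proof.
move=> k0 hk ka a1 ah; pose b n : L := neumann_sum a k n; pose s n := <|x, b n x|>.
have b1 n : leH (b n) 1 by exact: (neumann_sum_le1 k0 hk ka a1 ah).
have s_nd : nondecreasing_seq s.
  move=> m n mn.
  by have /leH_rinnerP[_ _] := neumann_sum_le k0 hk ka ah mn; exact.
have s_ub n : s n <= <|x, x|> by have /leH_rinnerP[_ _] := b1 n; exact.
have s_cvg : cvgn s.
  by apply: nondecreasing_is_cvgn => //; exists <|x, x|> => _ [n _ <-].
have b_diff m n : (m <= n)%N -> |`b m x - b n x| ^+ 2 <= s n - s m.
  move=> mn; rewrite -inormN opprB -[b n x - b m x]/(op (b n - b m) x).
  have /leH_rinnerP[_ hbb /(_ x)] := neumann_sum_diff_sqr k0 hk ka a1 ah mn.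
  by rewrite -{1}hbb rinner_star_mul rinnerBr.
move=> e e0; have /cvgrPdist_lt /(_ _ (exprn_gt0 2 e0)) [N _ sN] := s_cvg.
have main m n : (N <= m)%N -> (m <= n)%N -> |`b m x - b n x| < e.
  move=> Nm mn; rewrite -(ltr_pXn2r (n := 2)) ?nnegrE ?inorm_ge0 ?(ltW e0) //.
  apply: le_lt_trans (b_diff _ _ mn) _; apply: le_lt_trans (sN m Nm).
  apply: le_trans (ler_norm _); rewrite lerD2r.
  exact: nondecreasing_cvgn_le.
exists N => m n Nm Nn; have [mn|/ltnW nm] := leqP m n; first exact: main.
by rewrite -inormN opprB; exact: main.
Qed.

Hypothesis Q_invertible : forall q, Q q -> invertible q.

Lemma down_algebra_inverse (a : L) : S a -> leH 1 a ->
  exists b, [/\ S b, a * b = 1 & b * a = 1].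
Proof.
move=> Sa a1; have [_ ha] := leH_herm a1; have aQ : commutant Q a by case: Sa.
have [q Qq aq] := down_algebra_le_star_mul Q_dominant Sa ha.
have [[_ Qcomm Qstar Q1] [_ _ QM]] := Q_dominant.
have [h [Qh ah h0]] : exists h : L, [/\ Q h, leH a h & leH 0 h].
  by exists (q^*s * q); split=> //; [apply: QM => //; exact: Qstar|exact: leH0_sqr].
have [k [hk kh]] : exists k : L, h * k = 1 /\ k * h = 1 by exact: Q_invertible.
have k_comm (c : L) : c * h = h * c -> c * k = k * c.
  by move=> ch; rewrite -[LHS]mul1r -kh -mulrA (mulrA h) -ch -!mulrA hk mulr1.
have kQ : commutant Q k.
  by move=> r Qr; apply/esym/k_comm/Qcomm.
have hermh := leH0_herm h0.
have hermk : is_hermitian k.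
  by rewrite /is_hermitian -[LHS]mulr1 -hk mulrA -{1}hermh -starM hk star1 mul1r.
have k0 : leH 0 k.
  (* Here [k = k^* h k] is a conjugate of [h]. *)
  by have := leH0_conj k h0; rewrite hermk kh mul1r.
have ka : k * a = a * k by apply/esym/k_comm/aQ.
pose u n : L := neumann_sum a k n.
have uQ n : commutant Q (u n).
  move=> r Qr; apply/commr_sym/neumann_sum_comm; apply/commr_sym; [exact: aQ|exact: kQ].
have uh n : (u n)^*s = u n by exact/leH0_herm/(neumann_sum_ge0 k0 hk ka ah).
have u_cauchy x := neumann_sum_strong_cauchy x k0 hk ka a1 ah.
have [w [wQ uw uw']] : exists w : L, [/\ commutant Q w,
    forall x, strong_lim form (fun n => u n x) (w x) &
    forall x, strong_lim form (fun n => op (u n)^*s x) (op w^*s x)].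
  apply: down_algebra_strong_limit => // [n|x]; first by rewrite uh.
  by rewrite (_ : (fun n => _) = fun n => u n x) //; apply/funext => n; rewrite uh.
have hw : w^*s = w.
  apply: opP => x; apply: strong_lim_unique (uw x).
  by rewrite (_ : (fun n => u n x) = fun n => op (u n)^*s x) //; apply/funext => n; rewrite uh.
(* From [u_n^2 <= u_n <= 1] each [u n] is a contraction, and so is the limit; hence the unit of [Q]
   dominates [w]. *)
have w1 x : |`w x| <= |`x|.
  apply: strong_lim_inorm_le (uw x) _; exists 0 => n _.
  rewrite -(ler_pXn2r (n := 2)) ?nnegrE ?inorm_ge0 //.
  rewrite -rinner_star_mul inorm_sqr uh.
  have u1 : leH (u n) 1 by exact: neumann_sum_le1 k0 hk ka a1 ah n.
  have /leH_rinnerP[_ _] := leH_trans (sqr_leH (neumann_sum_ge0 k0 hk ka ah n) u1) u1.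
  exact.
have aw : a * w = 1.
  (* The recursion [neumann_sumS] is paired with [z], and [k] and [a] are moved onto [z] as
     adjoints. The shifted sequence has the same limit, so the correction term vanishes; applying
     [h] then removes [k]. *)
  have kaw x : k x = k (a (w x)).
    apply: (@rinner_injr _ _ form) => z.
    have lw := strong_lim_rinner z (uw x).
    have lw' : <|z, u n.+1 x|> @[n --> \oo] --> <|z, w x|>.
      by rewrite (cvg_shiftS (fun n => <|z, u n x|>)).
    have : <|z, w x|> = <|z, w x|> + (<|z, k x|> - <|z, k (a (w x))|>).
      apply: cvg_unique lw' _ => //.
      rewrite (_ : (fun n => _) = (fun n =>
          <|z, u n x|> + (<|z, k x|> - <|op a^*s (op k^*s z), u n x|>))).
        apply: cvgD => //; apply: cvgB; first exact: cvg_cst.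
        have -> : <|z, k (a (w x))|> = <|op a^*s (op k^*s z), w x|>.
          by rewrite !rinner_op !starK.
        exact: strong_lim_rinner.
      apply/funext => n; rewrite /u neumann_sumS opD rinnerDr; congr (_ + _).
      rewrite -[op (k * _) x]/(k (x - a (u n x))) opDr opN rinnerBr; congr (_ - _).
      by rewrite !rinner_op !starK.
    by move=> /eqP; rewrite -{1}[<|z, w x|>]addr0 (inj_eq (addrI _)) eq_sym subr_eq0 => /eqP.
  apply: opP => x.
  have := congr1 h (kaw x); rewrite -!(opM h k) hk.
  by [].
have wa : w * a = 1 by rewrite -[LHS]starK starM hw ha aw star1.
exists w; split=> //; split=> //; exists 1 => //; rewrite hw.
suff : leH (w^*s * w) (1^*s * 1) by rewrite hw.
exact/leH_star_mulP.
Qed.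

End InvertibleDominant.

(** * The two directions of the equivalence *)

Theorem theorem8p8 (R : realType) (D : lmodType R[i])
    (form : {dot D for @Num.conj R[i]}) (Q : set (Lstar form))
    (Q_dominant : dominant Q)
    (QO : Ostar_algebra (down_algebra Q)) (Q_closed : Ostar_closed (down_algebra Q)) :
  Su_star_algebra (sub_algebra QO) <-> (forall q, Q q -> invertible q).
Proof.
split=> [[_ _ coer_inv] q Qq|Q_inv].
  have [[qn _ _ _] [Qcoer _ _]] := Q_dominant.
  have Sq : down_algebra Q (q^*s * q).
    have [_ _ _ SM SV] := QO; have Sq := dominant_down Q_dominant Qq.
    by apply: SM => //; exact: SV.
  have [e e0 eq] := Qcoer q Qq.
  have [|b [qb bq]] := coer_inv (Sub (q^*s * q) (mem_set Sq)); first by exists e.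
  have {}qb : q^*s * q * val b = 1 by exact: (congr1 val qb).
  have {}bq : val b * (q^*s * q) = 1 by exact: (congr1 val bq).
  (* Normality turns the inverse of [q^* q] into a right inverse of [q] beside the left inverse
     [b q^*]; the two coincide. *)
  have qb' : q * (q^*s * val b) = 1 by rewrite mulrA -qn.
  have bq' : val b * q^*s * q = 1 by rewrite -mulrA.
  exists (q^*s * val b); split=> //.
  by rewrite -[q^*s * val b]mul1r -{1}bq' -(mulrA _ q) qb' mulr1.
split.
- move=> v w hv hw vw.
  apply/(leH_rinnerP (val v) 0); split; [exact: (congr1 val hv)|exact: star0|].
  move=> x; rewrite -[op 0 x]/(0 : D) rinner0r.
  have vwx (e : R) : 0 < e ->
      rinner form x (op (val v) x) <= e * rinner form x (op (val w) x).
    by move=> /vw /(leH_rinnerP (val v))[_ _ /(_ x)]; rewrite -rinnerZr_real.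
  apply/ler_addgt0Pl => e e0; rewrite addr0.
  (* Taking [e] divided by this positive bound on [<x, w x>] in the hypothesis gives
     [<x, v x> <= e]. *)
  have d0 : 0 < `|rinner form x (op (val w) x)| + 1 by rewrite ltr_wpDl.
  apply: le_trans (vwx _ (divr_gt0 e0 d0)) _.
  rewrite mulrAC ler_pdivrMr // ler_pM2l //.
  by apply: le_trans (ler_norm _) _; rewrite lerDl.
- exact: down_algebra_uniformly_complete.
- move=> a [e e0 ea]; have Sa : down_algebra Q (val a) by exact/set_mem/(valP a).
  have [_ _ SZ _ _] := QO.
  have ei0 : 0 < e^-1 by rewrite invr_gt0.
  (* Rescaling by [e^-1] moves the coercive element above 1; the same factor reappears in its
     inverse [e^-1 b]. *)
  have [||b [Sb ab ba]] := down_algebra_inverse Q_dominant QO Q_closed Q_inv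
      (a := rtoC e^-1 *c val a).
  + exact: SZ.
  + have {ea} /(leH_rinnerP _ (val a))[_ ha ea] := ea.
    apply/leH_rinnerP; split=> [||x]; first exact: star1.
      by rewrite /is_hermitian starZ ha; congr (_ *c _); exact: conjc_real.
    rewrite -[op (_ *c val a) x]/(rtoC e^-1 *: op (val a) x) rinnerZr_real.
    by rewrite ler_pdivlMl // -rinnerZr_real; exact: ea.
  + exists (Sub (rtoC e^-1 *c b) (mem_set (SZ _ _ Sb))).
    split; apply: val_inj.
      by rewrite -[LHS]/(val a * (rtoC e^-1 *c b)) -cscaleAr cscaleAl ab.
    by rewrite -[LHS]/(rtoC e^-1 *c b * val a) -cscaleAl cscaleAr ba.
Qed.
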